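(* Let $P$ be a finite geometric lattice of rank $n$, fix a total order on its atoms, and let $S=\{s_1<s_2<\dots<s_k\}\subseteq\{1,\dots,n-1\}$. Let $R=\mathrm{Rib}(s_1,s_2-s_1,\dots,s_k-s_{k-1},n-s_k)$. Then the elements $\bar f_{chain}(v_F)$, where $F$ ranges over the standard fillings of $R$ whose reading word is an $\mathrm{NBC}^+$ basis of $P$, form a basis of the top reduced homology $\tilde H_{k-1}(\Delta(P^S);\mathbb C)$ of the rank-selected subposet $P^S$.
   Context: A geometric lattice is a finite atomic semimodular lattice; for $x\in P$, $A(x)$ is the set of atoms $a\le x$. $P^S$ is the set of elements of $P$ with rank in $S$, and $\Delta(P^S)$ its order complex (simplices = chains), with oriented simplices written as chains in increasing order. An NBC independent set is a set $\{a_{1},\dots,a_{l}\}$ of atoms whose join has rank $l$ and such that every atom $a\notin\{a_1,\dots,a_l\}$ with $a\le a_1\vee\dots\vee a_l$ comes later in the atom order than at least one $a_j$. An $\mathrm{NBC}^+$ basis is an ordered NBC independent set $(a_{1},\dots,a_{r})$ with $r=\mathrm{rk}(P)$ such that for each $j$, $a_{j}=\min\big(A(a_1\vee\dots\vee a_j)\setminus A(a_1\vee\dots\vee a_{j-1})\big)$ (minimum in the atom order). The ribbon $\mathrm{Rib}(r_1,\dots,r_m)$ is the connected skew diagram with no $2\times2$ square whose rows, from bottom to top, have lengths $r_1,\dots,r_m$, each row beginning in the column of the last box of the row below (directly above it). A filling places one atom in each box; its reading word lists the entries left to right within rows, rows taken bottom to top. A filling is standard if entries increase (in atom order) left to right along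 rows and from top to bottom down columns. The tabloid $\{F\}$ is the class of $F$ modulo permuting entries within rows. The column group $\mathrm{Col}_F$ consists of permutations of entries preserving each column, and $v_F:=\sum_{\sigma\in\mathrm{Col}_F}\mathrm{sgn}(\sigma)\{\sigma F\}$. For a filling of $R$ whose entries form a basis of the matroid (i.e. $n$ atoms with join $\hat1$) and reading word $(F_1,\dots,F_n)$, $\bar f_{chain}(\{F\})$ is the maximal chain $F_1\vee\dots\vee F_{s_1}<F_1\vee\dots\vee F_{s_2}<\dots<F_1\vee\dots\vee F_{s_k}$ of $P^S$, viewed as an oriented $(k-1)$-simplex; $\bar f_{chain}$ is extended linearly. *)

(* Defs.v *)
From HB Require Import structures.
From mathcomp Require Import all_boot all_order all_algebra all_fingroup.
From mathcomp Require Import reals complex.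
Set Implicit Arguments.
Unset Strict Implicit.
Unset Printing Implicit Defensive.
Import Order.TTheory GRing.Theory Num.Theory.

Section Lattice.
Context {disp : Order.disp_t} (L : finTBLatticeType disp).

Definition covers (x y : L) : bool :=
  (x < y)%O && [forall z : L, ~~ ((x < z)%O && (z < y)%O)].
Definition atom (a : L) : bool := covers \bot%O a.

Definition atomic : Prop :=
  forall x : L, exists A : {set L}, {in A, forall a, atom a} /\
    x = (\join_(a in A) a)%O.

Definition semimodular : Prop :=
  forall a b : L, covers (a `&` b)%O a -> covers (a `&` b)%O b ->
    covers a (a `|` b)%O /\ covers b (a `|` b)%O.

Definition geometric : Prop := atomic /\ semimodular.

(** rank of x = length of a longest chain \bot = x_0 < x_1 < ... < x_r = x;
    computed with fuel #|L| (which bounds all chain lengths). *)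
Fixpoint height (m : nat) (x : L) : nat :=
  if m is m'.+1 then \max_(y : L | (y < x)%O) (height m' y).+1 else 0.
Definition rank (x : L) : nat := height #|L| x.

Definition joinseq (s : seq L) : L := (\join_(a <- s) a)%O.

Definition atom_order (ao : seq L) : Prop :=
  uniq ao /\ forall a : L, atom a = (a \in ao).
Definition aprec (ao : seq L) (a b : L) : bool := index a ao < index b ao.

Definition nbc_indep (ao : seq L) (s : seq L) : Prop :=
  [/\ uniq s, all atom s, rank (joinseq s) = size s &
      forall a : L, atom a -> a \notin s -> (a <= joinseq s)%O ->
        has (fun b => aprec ao b a) s].

Definition nbc_plus (ao : seq L) (s : seq L) : Prop :=
  [/\ nbc_indep ao s, size s = rank \top%O &
      forall j, j < size s ->
        let a := nth \bot%O s j in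
        [/\ atom a, (a <= joinseq (take j.+1 s))%O,
            ~~ (a <= joinseq (take j s))%O &
            forall b : L, atom b -> (b <= joinseq (take j.+1 s))%O ->
              ~~ (b <= joinseq (take j s))%O -> ~~ aprec ao b a]].

(** ---------------- Ribbons ----------------
   For S = {s_1 < ... < s_k} and n, the ribbon
   R = Rib(s_1, s_2 - s_1, ..., n - s_k) has n boxes.  We index its boxes by
   their position p in {0,...,n-1} in reading order (left to right in rows,
   rows bottom to top).  Row r (r = 0 is the bottom row) consists of the
   positions s_r <= p < s_(r+1) (with s_0 = 0, s_(k+1) = n).  Since each row
   begins in the column of the last box of the row below, the box at reading
   position p lies in row [rib_row S p] and column [rib_col S p] below. *)
Definition rib_row (S : seq nat) (p : nat) : nat := count (fun s => s <= p) S.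
Definition rib_col (S : seq nat) (p : nat) : nat := p - rib_row S p.

(** A filling is determined by its reading word w (w_p is the entry of the
    box at reading position p).  It is standard if entries increase (atom
    order) left to right along rows and from top to bottom down columns
    (a box in a higher row is above). *)
Definition standard (ao : seq L) (S : seq nat) (w : seq L) : Prop :=
  all atom w /\
  forall p q, p < size w -> q < size w ->
    (rib_row S p = rib_row S q -> rib_col S p < rib_col S q ->
       aprec ao (nth \bot%O w p) (nth \bot%O w q)) /\
    (rib_col S p = rib_col S q -> rib_row S q < rib_row S p ->
       aprec ao (nth \bot%O w p) (nth \bot%O w q)).

Definition col_group (S : seq nat) (n : nat) : {set {perm 'I_n}} :=
  [set s : {perm 'I_n} | [forall p : 'I_n, rib_col S (s p) == rib_col S p]].

(** sigma F : the entry of box p moves to box sigma p *)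
Definition act_filling n (s : {perm 'I_n}) (w : n.-tuple L) : seq L :=
  [seq tnth w ((s^-1)%g p) | p <- enum 'I_n].

Definition fchain (S : seq nat) (u : seq L) : (size S).-tuple L :=
  [tuple joinseq (take (nth 0 S i) u) | i < size S].

(** ------------- order complex of P^S and its chain complex -------------
   An oriented (j-1)-simplex of Delta(P^S) is a chain x_1 < ... < x_j of
   elements with ranks in S, written in increasing order (j = 0: the empty
   simplex, which gives the reduced complex).  (j-1)-chains with coefficients
   in C are functions on j-tuples supported on such simplices. *)
Definition simplexS (S : seq nat) (c : seq L) : bool :=
  sorted (fun x y => (x < y)%O) c && all (fun x => rank x \in S) c.

Definition delete_at (i : nat) (c : seq L) : seq L := take i c ++ drop i.+1 c.

Variable C : fieldType.

Definition supported (S : seq nat) j (z : {ffun j.-tuple L -> C}) : Prop :=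
  forall t : j.-tuple L, ~~ simplexS S t -> z t = 0%R.

Definition bdry (S : seq nat) j (z : {ffun j.-tuple L -> C}) (u : seq L) : C :=
  (\sum_(t : j.-tuple L | simplexS S t)
     \sum_(i < j) (-1) ^+ i * (u == delete_at i t)%:R * z t)%R.

Definition is_cycle (S : seq nat) j (z : {ffun j.-tuple L -> C}) : Prop :=
  supported S z /\ forall u : seq L, bdry S z u = 0%R.

Definition is_boundary (S : seq nat) j (z : {ffun j.-tuple L -> C}) : Prop :=
  exists y : {ffun j.+1.-tuple L -> C},
    supported S y /\ forall t : j.-tuple L, z t = bdry S y t.

Definition fchain_vF (S : seq nat) n (w : n.-tuple L) :
    {ffun (size S).-tuple L -> C} :=
  [ffun c => (\sum_(s in col_group S n)
      (-1) ^+ odd_perm s * (c == fchain S (act_filling s w))%:R)%R].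

End Lattice.

(* Main.v *)
Require Import Defs.
From HB Require Import structures.
From mathcomp Require Import all_boot all_order all_algebra all_fingroup.
From mathcomp Require Import reals complex.
From mathcomp Require Import boolp zify.
Set Implicit Arguments.
Unset Strict Implicit.
Unset Printing Implicit Defensive.
Import Order.TTheory GRing.Theory.

(** In top degree there are no boundaries, so the claim is about cycles.
    Call a basis word w_1 ... w_n of atoms greedy for S if each w_j is the least
    atom below w_1 v ... v w_j and not below w_1 v ... v w_(j-1), and w ascends
    at every position outside S.  A greedy word is lexicographically least among
    the basis words inducing the same chain of P^S, and every maximal chain of
    P^S comes from a greedy word; the fillings of the theorem are the greedy words
    that descend at every position of S.  Permuting the columns of such a filling
    F lowers its reading word, so f_chain(v_F) is the chain of F plus chains whose
    greedy words are smaller: the family is unitriangular.  Conversely, the chain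
    of a cycle's support with largest greedy word w must descend at each s in S: a
    second chain of the support shares with it the face omitting rank s, and an
    ascent at s would make w smaller than the word of that chain.  Subtracting
    multiples of the f_chain(v_F) thus reduces any cycle to zero. *)

(** * Ranks in a geometric lattice *)

Section Depth.
Context (T : finType) (r : rel T).

(** The recursion of [height] for an arbitrary relation: it serves for ranks and, read upwards
    inside an interval, for [coheight]. *)
Fixpoint depth (m : nat) (x : T) : nat :=
  if m is m'.+1 then \max_(y : T | r y x) (depth m' y).+1 else 0.

Context (r_tr : transitive r) (r_irr : irreflexive r).

(** A predecessor y of x has strictly fewer predecessors than x, since y is not its own predecessor;
    so y needs one unit of fuel less. *)
Lemma depth_stable m x : #|[set y | r y x]| <= m -> depth m.+1 x = depth m x.
Proof.
elim: m x => [|m IHm] x.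
  rewrite leqn0 cards_eq0 => /eqP r0 /=; rewrite big_pred0 // => y.
  by have := in_set0 y; rewrite -r0 inE.
move=> ltm; rewrite /= -/(depth m.+1).
apply: eq_bigr => y ryx; congr _.+1; apply: IHm.
rewrite -ltnS; apply: leq_trans ltm; apply: proper_card; apply/properP; split.
  by apply/subsetP => z; rewrite !inE => /r_tr; apply.
by exists y; rewrite !inE ?ryx ?r_irr.
Qed.

Lemma depth_rec x : depth #|T| x = \max_(y | r y x) (depth #|T| y).+1.
Proof. by rewrite -(depth_stable (max_card _)). Qed.

Lemma depth_lt x y : r x y -> depth #|T| x < depth #|T| y.
Proof.
move=> rxy; rewrite (depth_rec y).
exact: (@leq_bigmax_cond _ (fun z => r z y) (fun z => (depth #|T| z).+1)).
Qed.

Lemma depth_witness x y : r x y ->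
  exists2 z, r z y & depth #|T| y = (depth #|T| z).+1.
Proof.
move=> rxy; rewrite depth_rec.
have [|z rzy ->] := @eq_bigmax_cond _ (fun z => r z y) (fun z => (depth #|T| z).+1).
- by apply/card_gt0P; exists x.
by exists z.
Qed.

End Depth.

Section Rank.
Context (disp : Order.disp_t) (L : finTBLatticeType disp).
Implicit Types x y u c d : L.

Lemma rank_depth x : rank x = depth (fun y x : L => (y < x)%O) #|L| x.
Proof. by []. Qed.

Let below_tr : transitive (fun y x : L => (y < x)%O).
Proof. by move=> y x z; apply: lt_trans. Qed.

Let below_irr : irreflexive (fun y x : L => (y < x)%O).
Proof. by move=> x; apply: ltxx. Qed.

Lemma rank_lt x y : (x < y)%O -> rank x < rank y.
Proof.
by rewrite !rank_depth => lt_xy; apply: depth_lt.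
Qed.

Lemma rank_le x y : (x <= y)%O -> rank x <= rank y.
Proof. by rewrite le_eqVlt => /predU1P[->//|/rank_lt/ltnW]. Qed.

Lemma rank_eq x y : (x <= y)%O -> rank x = rank y -> x = y.
Proof. by rewrite le_eqVlt => /predU1P[//|/rank_lt]; rewrite ltn_neqAle => /andP[/eqP]. Qed.

Lemma rank_bot : rank (\bot : L)%O = 0.
Proof.
apply/eqP; rewrite -leqn0 rank_depth (depth_rec below_tr below_irr).
by apply/bigop.bigmax_leqP => y; rewrite ltx0.
Qed.

Lemma rank_witness x : x != \bot%O -> exists2 y, (y < x)%O & rank x = (rank y).+1.
Proof.
by rewrite -lt0x => /(depth_witness below_tr below_irr).
Qed.

Lemma coversP x y : reflect ((x < y)%O /\ forall z, (x < z)%O -> (z <= y)%O -> z = y)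
  (covers x y).
Proof.
apply: (iffP andP) => -[lt_xy no_z]; split => //.
  move=> z lt_xz; rewrite le_eqVlt => /predU1P[//|lt_zy].
  by move/forallP: no_z => /(_ z); rewrite lt_xz lt_zy.
apply/forallP => z; apply/negP => /andP[lt_xz lt_zy].
by have := no_z z lt_xz (ltW lt_zy) => eq_zy; rewrite eq_zy ltxx in lt_zy.
Qed.

Lemma exists_cover x y : (x < y)%O -> exists2 c, covers x c & (c <= y)%O.
Proof.
move=> lt_xy.
case: (@arg_minnP _ y (fun c => (x < c)%O && (c <= y)%O) (@rank _ L)).
  by rewrite lt_xy lexx.
move=> c /andP[lt_xc le_cy] minc; exists c => //.
apply/coversP; split=> // z lt_xz le_zc; apply: rank_eq => //; apply/eqP.
by rewrite eqn_leq rank_le // minc // lt_xz (le_trans le_zc).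
Qed.

(** For u below y, the length of a longest chain from u up to y. Semimodularity produces covers
    upwards, so chains are measured from their lower end. *)
Definition coheight y u : nat :=
  depth (fun d u : L => (u < d)%O && (d <= y)%O) #|L| u.

Let above_tr y : transitive (fun d u : L => (u < d)%O && (d <= y)%O).
Proof.
move=> d c u /andP[lt_dc le_cy] /andP[lt_ud _].
by rewrite (lt_trans lt_ud lt_dc) le_cy.
Qed.

Let above_irr y : irreflexive (fun d u : L => (u < d)%O && (d <= y)%O).
Proof. by move=> d; rewrite ltxx. Qed.

Lemma coheight_lt y u d : (u < d)%O -> (d <= y)%O -> coheight y d < coheight y u.
Proof. by move=> lt_ud le_dy; apply: depth_lt; rewrite ?lt_ud. Qed.

Lemma coheight_refl y : coheight y y = 0.
Proof.
rewrite /coheight depth_rec // big_pred0 // => d.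
by apply/negP => /andP[/lt_le_trans H /H]; rewrite ltxx.
Qed.

Lemma coheight_witness y u : (u < y)%O ->
  exists d, [/\ covers u d, (d <= y)%O & coheight y u = (coheight y d).+1].
Proof.
move=> lt_uy.
have [|d /andP[lt_ud le_dy] eq_d] :=
  depth_witness (@above_tr y) (@above_irr y) (x := y) (y := u).
  by rewrite lt_uy lexx.
(* Refining the first step from u to d into a cover c leaves a remainder that is at least as
   long. *)
have [c cov_c le_cd] := exists_cover lt_ud.
have le_cy := le_trans le_cd le_dy.
exists c; split=> //; apply/eqP; rewrite eqn_leq; apply/andP; split; last first.
  by apply: coheight_lt => //; case/coversP: cov_c.
rewrite /coheight eq_d ltnS; move: le_cd; rewrite le_eqVlt => /predU1P[->//|lt_cd].
exact: ltnW (coheight_lt lt_cd le_dy).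
Qed.

(** The sum [rank u + coheight y u] never drops when u steps down a longest chain to the bottom, nor
    when u steps up a longest chain to y. Comparing its values at y and at the bottom gives both
    inequalities. *)
Lemma rank_coheight y : rank y = coheight y \bot%O.
Proof.
apply/eqP; rewrite eqn_leq; apply/andP; split.
  suff: forall m u, rank u = m -> (u <= y)%O ->
      rank u + coheight y u <= coheight y \bot%O.
    by move/(_ _ y erefl (lexx _)); rewrite coheight_refl addn0.
  elim=> [|m IHm] u eq_m le_uy; have [->|u0] := eqVneq u \bot%O; rewrite ?rank_bot //.
    by have [v] := rank_witness u0; rewrite eq_m.
  have [v lt_vu eq_v] := rank_witness u0; rewrite eq_v in eq_m *; case: eq_m => eq_m.
  apply: leq_trans (IHm v eq_m (le_trans (ltW lt_vu) le_uy)).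
  by rewrite addSn -addnS leq_add2l coheight_lt.
suff: forall m u, coheight y u = m -> (u <= y)%O -> rank u + coheight y u <= rank y.
  by move/(_ _ \bot%O erefl (le0x _)); rewrite rank_bot.
elim=> [|m IHm] u eq_m le_uy; first by rewrite eq_m addn0 rank_le.
have [eq_uy|lt_uy] := eqVneq u y; first by rewrite eq_uy coheight_refl addn0.
have [|d [/coversP[lt_ud _] le_dy eq_d]] := @coheight_witness y u.
  by rewrite lt_neqAle lt_uy.
rewrite eq_d in eq_m *; case: eq_m => eq_m.
apply: leq_trans (IHm d eq_m le_dy).
by rewrite addnS -addSn leq_add2r rank_lt.
Qed.

Context (geoL : geometric L).

(* Jordan-Dedekind: two covers of u have a common cover, so all saturated
   chains from u to y have the same length. *)
Lemma coheight_covers y u c : covers u c -> (c <= y)%O ->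
  coheight y u = (coheight y c).+1.
Proof.
have [m] := ubnP (coheight y u); elim: m u c => // m IHm u c lt_m cov_c le_cy.
have /coversP[lt_uc min_c] := cov_c.
have [d [cov_d le_dy eq_d]] := coheight_witness (lt_le_trans lt_uc le_cy).
have /coversP[lt_ud min_d] := cov_d.
have [<-//|neq_dc] := eqVneq d c.
have eq_u : (c `&` d)%O = u.
  apply/eqP; apply: contraT => neq_u.
  have lt_u : (u < c `&` d)%O by rewrite lt_def neq_u lexI !ltW.
  have eqc := min_c _ lt_u (leIl _ _); have eqd := min_d _ lt_u (leIr _ _).
  by rewrite -eqc eqd eqxx in neq_dc.
have [] := (proj2 geoL) c d; rewrite ?eq_u // => cov_ce cov_de.
have le_ey : (c `|` d <= y)%O by rewrite leUx le_cy.
rewrite eq_d (IHm d _ _ cov_de le_ey); last by rewrite eq_d in lt_m.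
by rewrite (IHm c _ _ cov_ce le_ey) // (leq_trans (coheight_lt lt_uc le_cy)).
Qed.

(** Every u below x has coheight one larger in y than in x, by induction along a longest chain from
    u to x; the bottom element then gives the ranks. *)
Lemma covers_rank x y : covers x y -> rank y = (rank x).+1.
Proof.
move=> cov_xy; have /coversP[lt_xy _] := cov_xy; rewrite !rank_coheight.
suff: forall m u, coheight x u = m -> (u <= x)%O -> coheight y u = (coheight x u).+1.
  by move/(_ _ \bot%O erefl (le0x _)).
elim=> [|m IHm] u eq_m; rewrite le_eqVlt => /predU1P[->|lt_ux].
- by rewrite (coheight_covers cov_xy) // !coheight_refl.
- by have := coheight_lt lt_ux (lexx x); rewrite eq_m.
- by rewrite (coheight_covers cov_xy) // !coheight_refl.
have [d [cov_d le_dx eq_d]] := coheight_witness lt_ux.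
rewrite (coheight_covers cov_d (le_trans le_dx (ltW lt_xy))) eq_d.
by rewrite IHm //; move: eq_m; rewrite eq_d => -[].
Qed.

(** Induction on the rank of x: for z covered by x, the join of z and a also covers z, and
    semimodularity lifts this cover to x. *)
Lemma covers_join_atom x a : atom a -> ~~ (a <= x)%O -> covers x (x `|` a)%O.
Proof.
move=> at_a; have [m] := ubnP (rank x); elim: m x => // m IHm x lt_m a_x.
have [->|x0] := eqVneq x \bot%O; first by rewrite join0x.
have [z lt_zx eq_z] := rank_witness x0.
have cov_zx : covers z x.
  apply/coversP; split=> // u lt_zu le_ux; apply: rank_eq => //; apply/eqP.
  by rewrite eqn_leq rank_le // eq_z rank_lt.
have a_z : ~~ (a <= z)%O by apply: contra a_x => /le_trans/(_ (ltW lt_zx)).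
have cov_za : covers z (z `|` a)%O by apply: IHm => //; rewrite eq_z in lt_m.
(* Otherwise the two covers of z would coincide and a would lie below x. *)
have eq_I : (x `&` (z `|` a))%O = z.
  apply/eqP; apply: contraT => neq_I.
  have lt_I : (z < x `&` (z `|` a))%O by rewrite lt_def neq_I lexI leUl ltW.
  have /coversP[_ minx] := cov_zx; have eqx := minx _ lt_I (leIl _ _).
  have /coversP[_ mina] := cov_za; have eqa := mina _ lt_I (leIr _ _).
  by case/negP: a_x; rewrite -eqx eqa leUr.
have [] := (proj2 geoL) x (z `|` a)%O; rewrite ?eq_I //.
by rewrite joinA (join_l (ltW lt_zx)).
Qed.

Lemma rank_join_atom x a : atom a -> rank (x `|` a)%O = rank x + ~~ (a <= x)%O.
Proof.
move=> at_a; have [le_ax|nle_ax] := boolP (a <= x)%O.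
  by rewrite join_l // addn0.
by rewrite (covers_rank (covers_join_atom at_a nle_ax)) addn1.
Qed.

Lemma exists_atom x y : (x < y)%O ->
  exists a, [/\ atom a, (a <= y)%O & ~~ (a <= x)%O].
Proof.
move=> lt_xy; have [A [atA eqy]] := (proj1 geoL) y.
have [/existsP[a /andP[aA nle_ax]]|/existsPn allx] :=
  boolP [exists a, (a \in A) && ~~ (a <= x)%O].
  by exists a; split=> //; [apply: atA | rewrite eqy joins_sup].
suff le_yx : (y <= x)%O by have := lt_le_trans lt_xy le_yx; rewrite ltxx.
rewrite eqy; apply/joinsP => a aA.
by have := allx a; rewrite aA negbK.
Qed.

End Rank.

(** * Lexicographic codes and ribbon rows *)

(** Base M value, most significant digit first. On lists of equal length with digits below M it
    turns lexicographic comparison into the order of nat, which suits maxima and inductions. *)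
Fixpoint enc (M : nat) (s : seq nat) : nat :=
  if s is d :: s' then d * M ^ size s' + enc M s' else 0.

Lemma enc_bound M s : all (fun d => d < M) s -> enc M s < M ^ size s.
Proof.
elim: s => [|d s IHs] //= /andP[ltd /IHs lts].
rewrite expnS; apply: (@leq_trans (d * M ^ size s + M ^ size s)).
  by rewrite ltn_add2l.
by rewrite -mulSnr leq_mul2r ltd orbT.
Qed.

Lemma enc_lt M s t p : all (fun d => d < M) s -> size s = size t ->
  p < size s -> take p s = take p t -> nth 0 s p < nth 0 t p ->
  enc M s < enc M t.
Proof.
elim: s t p => [|d s IHs] [|e t] //= [|p] /andP[_ lts] [eq_sz] ltp //=.
  move=> _ lt_de; rewrite eq_sz.
  apply: (@leq_trans (d.+1 * M ^ size t)); last first.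
    by rewrite (leq_trans _ (leq_addr _ _)) // leq_mul2r lt_de orbT.
  by rewrite mulSnr ltn_add2l -eq_sz enc_bound.
by move=> [-> eq_tk] ltn; rewrite eq_sz ltn_add2l (IHs _ p).
Qed.

Lemma first_difference (T : eqType) (x0 : T) (s t : seq T) :
  size s = size t -> s != t ->
  exists p, [/\ p < size s, take p s = take p t & nth x0 s p != nth x0 t p].
Proof.
elim: s t => [|a s IHs] [|b t] //= [eq_sz].
have [<-|neq_ab _] := eqVneq a b; last by exists 0.
rewrite eqseq_cons eqxx /= => /(IHs _ eq_sz)[p [ltp eqp neqp]].
by exists p.+1; rewrite /= eqp.
Qed.

Section RibbonRows.
Context (S : seq nat) (S_sorted : sorted ltn S).

(** In an ascending [S] the elements at most q form an initial segment of length [rib_row S q]. *)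
Lemma leq_nth_rib_row q i : i < size S -> (nth 0 S i <= q) = (i < rib_row S q).
Proof.
rewrite /rib_row; elim: S S_sorted i => [|s S' IHS] //= pthS i lti.
have gt_s : all (fun s' => s < s') S' by apply: order_path_min pthS; apply: ltn_trans.
have [le_sq|lt_qs] := leqP s q.
  by case: i lti => [|i] lti //=; rewrite add1n ltnS IHS // (path_sorted pthS).
have -> : count (fun s' => s' <= q) S' = 0.
  apply/eqP; rewrite eqn0Ngt -has_count; apply/hasPn => s' /(allP gt_s) lt_ss'.
  by rewrite -ltnNge (ltn_trans lt_qs).
case: i lti => [|i] lti /=; first by rewrite leqNgt lt_qs.
by apply/negbTE; rewrite -ltnNge (ltn_trans lt_qs) // (allP gt_s) ?mem_nth.
Qed.

Lemma rib_rowS q : rib_row S q.+1 = rib_row S q + (q.+1 \in S).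
Proof.
have S_uniq : uniq S by apply: sorted_uniq S_sorted; [apply: ltn_trans|apply: ltnn].
rewrite -(count_uniq_mem _ S_uniq) /rib_row; elim: S => //= s S' ->; lia.
Qed.

Context (S_gt0 : all (fun s => 0 < s) S).

Lemma rib_row0 : rib_row S 0 = 0.
Proof.
apply/eqP; rewrite eqn0Ngt -has_count; apply/hasPn => s /(allP S_gt0).
by rewrite -ltnNge.
Qed.

Lemma rib_row_le q : rib_row S q <= q.
Proof. by elim: q => [|q IHq]; rewrite ?rib_row0 ?rib_rowS //; lia. Qed.

(** A step in reading order goes either up one row or right one column; [rib_row_le] keeps the
    subtraction in [rib_col] from truncating. *)
Lemma rib_colS q : rib_col S q.+1 = rib_col S q + (q.+1 \notin S).
Proof. by rewrite /rib_col rib_rowS; have := rib_row_le q; lia. Qed.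

Lemma rib_row_homo p q : p <= q -> rib_row S p <= rib_row S q.
Proof.
by apply: (homo_leq leqnn leq_trans) => r; rewrite rib_rowS leq_addr.
Qed.

Lemma rib_col_homo p q : p <= q -> rib_col S p <= rib_col S q.
Proof.
by apply: (homo_leq leqnn leq_trans) => r; rewrite rib_colS leq_addr.
Qed.

End RibbonRows.

(** * Basis words and greedy words *)

Section Words.
Context (disp : Order.disp_t) (L : finTBLatticeType disp).
Implicit Types (s u w : seq L) (a b : L).
Local Notation J w j := (joinseq (take j w)).

Lemma joinseq_nil : joinseq [::] = \bot%O :> L.
Proof. exact: big_nil. Qed.

Lemma joinseq_rcons s a : joinseq (rcons s a) = (joinseq s `|` a)%O.
Proof. by rewrite /joinseq -cats1 big_cat big_seq1. Qed.

Lemma joinseq_perm s u : perm_eq s u -> joinseq s = joinseq u.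
Proof. exact: perm_big. Qed.

Lemma joinseqS w j : j < size w -> J w j.+1 = (J w j `|` nth \bot w j)%O.
Proof. by move=> ltj; rewrite (take_nth \bot%O) // joinseq_rcons. Qed.

Lemma joinseq_homo w i j : i <= j -> (J w i <= J w j)%O.
Proof.
apply: (@homo_leq _ (fun j => J w j) <=%O (@lexx _ L) (@le_trans _ L)) => q.
have [ltq|leq] := ltnP q (size w); first by rewrite joinseqS // leUl.
by rewrite !take_oversize // leqW.
Qed.

Lemma nth_le_joinseq w i j : i < j -> (nth \bot w i <= J w j)%O.
Proof.
move=> lt_ij; have [lti|lei] := ltnP i (size w); last by rewrite nth_default ?le0x.
by apply: le_trans (joinseq_homo w lt_ij); rewrite joinseqS // leUr.
Qed.

Lemma joinseq_le w j x :
  (forall i, i < j -> (nth \bot w i <= x)%O) -> (J w j <= x)%O.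
Proof.
elim: j => [|j IHj] le_x; first by rewrite take0 joinseq_nil le0x.
have [ltj|lej] := ltnP j (size w).
  by rewrite joinseqS // leUx IHj ?le_x // => i lti; apply/le_x/ltnW.
by rewrite take_oversize 1?leqW // -(take_oversize lej) IHj // => i lti; apply/le_x/ltnW.
Qed.

Definition basis_word w :=
  [&& all (@atom _ L) w, size w == rank (\top : L)%O & joinseq w == \top%O].

Lemma basis_word_perm u w : perm_eq u w -> basis_word u = basis_word w.
Proof.
move=> eq_uw.
by rewrite /basis_word (perm_all _ eq_uw) (perm_size eq_uw) (joinseq_perm eq_uw).
Qed.

Lemma nth_atom w j : all (@atom _ L) w -> j < size w -> atom (nth \bot%O w j).
Proof. by move=> /allP at_w ltj; apply/at_w/mem_nth. Qed.

Section Geometric.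
Context (geoL : geometric L).

Lemma rank_joinseq_cat s u : all (@atom _ L) u ->
  rank (joinseq (s ++ u)) <= rank (joinseq s) + size u.
Proof.
elim/last_ind: u => [|u a IHu]; first by rewrite cats0 addn0.
rewrite all_rcons => /andP[at_a /IHu le_u].
rewrite -rcons_cat joinseq_rcons (rank_join_atom geoL) // size_rcons addnS -addn1.
by rewrite leq_add // leq_b1.
Qed.

Lemma rank_joinseq_le s : all (@atom _ L) s -> rank (joinseq s) <= size s.
Proof. by move=> /(rank_joinseq_cat [::]); rewrite joinseq_nil rank_bot. Qed.

(** The first j letters span rank at most j and each remaining letter adds at most one, yet together
    they reach the full rank. *)
Lemma basis_word_rank w j : basis_word w -> j <= size w -> rank (J w j) = j.
Proof.
case/and3P=> at_w /eqP sz_w /eqP top_w lej; apply/eqP; rewrite eqn_leq.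
move: at_w; rewrite -{1}(cat_take_drop j w) all_cat => /andP[at_tk at_dr].
rewrite (leq_trans (rank_joinseq_le at_tk)) ?size_takel //=.
have := rank_joinseq_cat (take j w) at_dr.
by rewrite cat_take_drop top_w -sz_w size_drop; lia.
Qed.

Lemma basis_word_nle w j : basis_word w -> j < size w ->
  ~~ (nth \bot w j <= J w j)%O.
Proof.
move=> bas_w ltj; apply/negP => le_j.
have := basis_word_rank bas_w ltj; rewrite joinseqS // (join_l le_j).
by rewrite basis_word_rank 1?ltnW //; lia.
Qed.

Lemma basis_wordI w : all (@atom _ L) w -> size w = rank (\top : L)%O ->
  (forall j, j < size w -> ~~ (nth \bot w j <= J w j)%O) -> basis_word w.
Proof.
move=> at_w sz_w nle_w; rewrite /basis_word at_w sz_w eqxx /=; apply/eqP.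
apply: rank_eq; rewrite ?lex1 // -[in LHS](take_size w) -sz_w.
suff: forall j, j <= size w -> rank (J w j) = j by apply.
elim=> [|j IHj] ltj; first by rewrite take0 joinseq_nil rank_bot.
by rewrite joinseqS // (rank_join_atom geoL) ?nth_atom // nle_w // IHj 1?ltnW // addn1.
Qed.

Lemma basis_word_uniq w : basis_word w -> uniq w.
Proof.
move=> bas_w; apply/(uniqP \bot%O) => i j; rewrite !inE => lti ltj eq_ij.
case: (ltngtP i j) => // lt_ij.
  by have := basis_word_nle bas_w ltj; rewrite -eq_ij nth_le_joinseq.
by have := basis_word_nle bas_w lti; rewrite eq_ij nth_le_joinseq.
Qed.

Context (ao : seq L) (ao_atoms : atom_order ao).

Lemma mem_ao a : (a \in ao) = atom a.
Proof. by rewrite (proj2 ao_atoms). Qed.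

Lemma index_ao_inj a b : atom a -> atom b -> index a ao = index b ao -> a = b.
Proof. by rewrite -!mem_ao => ina inb; apply: (index_inj \bot%O). Qed.

Definition code w := enc (size ao) [seq index a ao | a <- w].

Lemma code_lt u w p : all (@atom _ L) u -> size u = size w -> p < size u ->
  take p u = take p w -> aprec ao (nth \bot u p)%O (nth \bot w p)%O -> code u < code w.
Proof.
move=> at_u eq_sz ltp eq_tk lt_p; apply: (@enc_lt _ _ _ p); rewrite ?size_map //.
- by apply/allP => _ /mapP[a /(allP at_u) at_a ->]; rewrite index_mem mem_ao.
- by rewrite -!map_take eq_tk.
by rewrite !(nth_map \bot%O) // -eq_sz.
Qed.

Lemma code_inj u w : all (@atom _ L) u -> all (@atom _ L) w -> size u = size w ->
  code u = code w -> u = w.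
Proof.
move=> at_u at_w eq_sz eq_code; apply/eqP; apply: contraT => neq_uw.
have [p [ltp eq_tk neq_p]] := first_difference \bot%O eq_sz neq_uw.
have ltpw : p < size w by rewrite -eq_sz.
case: (ltngtP (index (nth \bot%O u p) ao) (index (nth \bot%O w p) ao)) => cmp_p.
- by have := code_lt at_u eq_sz ltp eq_tk cmp_p; rewrite eq_code ltnn.
- by have := code_lt at_w (esym eq_sz) ltpw (esym eq_tk) cmp_p; rewrite eq_code ltnn.
by rewrite (index_ao_inj _ _ cmp_p) ?eqxx ?nth_atom in neq_p.
Qed.

(** Letters are numbered from 0: letter j.+1 opens a new ribbon row exactly when j.+1 is in [S], so
    the last clause is increase along rows. *)
Definition greedy (S : seq nat) w : Prop :=
  [/\ basis_word w,
      forall j, j < size w -> forall b, atom b -> (b <= J w j.+1)%O ->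
        ~~ (b <= J w j)%O -> ~~ aprec ao b (nth \bot w j)%O &
      forall j, j.+1 < size w -> j.+1 \notin S ->
        aprec ao (nth \bot w j)%O (nth \bot w j.+1)%O].

Lemma greedy_ascent S w p q : greedy S w -> p <= q -> q < size w ->
  (forall j, p < j <= q -> j \notin S) ->
  index (nth \bot%O w p) ao <= index (nth \bot%O w q) ao.
Proof.
case=> _ _ asc; elim: q => [|q IHq]; first by rewrite leqn0 => /eqP->.
rewrite leq_eqVlt => /predU1P[->//|lt_pq] ltq offS.
apply: leq_trans (IHq lt_pq (ltnW ltq) _) _ => [j /andP[ltj lej]|].
  by apply: offS; rewrite ltj leqW.
by apply/ltnW/asc => //; apply: offS; rewrite lt_pq leqnn.
Qed.

(** The atom b enters the prefix joins at some step q between p and e. There it does not precede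
    letter q, and w ascends from p to q. *)
Lemma greedy_min S w p e b : greedy S w -> e <= size w ->
  (forall j, p < j < e -> j \notin S) ->
  atom b -> (b <= J w e)%O -> ~~ (b <= J w p)%O -> ~~ aprec ao b (nth \bot w p)%O.
Proof.
move=> gw; have [_ locmin _] := gw; elim: e => [|e IHe] lte offS at_b le_be nle_bp.
  by rewrite take0 joinseq_nil in le_be; rewrite (le_trans le_be (le0x _)) in nle_bp.
have [le_pe|lt_ep] := leqP p e; last first.
  by rewrite (le_trans le_be (joinseq_homo w lt_ep)) in nle_bp.
have [le_e|nle_e] := boolP (b <= J w e)%O.
  by apply: IHe => //; [apply: ltnW | move=> j /andP[? ?]; apply: offS; lia].
apply: contra (locmin e lte b at_b le_be nle_e) => /leq_trans; apply.
by apply: (greedy_ascent gw) => // j; rewrite -ltnS; apply: offS.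
Qed.

(* A greedy word is lexicographically least among the basis words inducing the
   same flats at the ranks in S. *)
Lemma greedy_code_le S w u : greedy S w -> basis_word u ->
  (forall j, j \in S -> J u j = J w j) -> code w <= code u.
Proof.
move=> gw bas_u eq_J; have [bas_w _ _] := gw.
have [/and3P[at_w /eqP sz_w /eqP top_w]] := (bas_w).
have [/and3P[at_u /eqP sz_u /eqP top_u]] := (bas_u).
have [->//|neq_uw] := eqVneq u w.
have [p [ltp eq_tk neq_p]] := first_difference \bot%O (etrans sz_u (esym sz_w)) neq_uw.
rewrite sz_u in ltp.
(* The least such e is the next element of [S] after p, or the end of the word; the flats of u and w
   agree there. *)
have ex_e : exists e, (p < e) && ((e \in S) || (e == size w)).
  by exists (size w); rewrite eqxx orbT sz_w ltp.
case: (ex_minnP ex_e) => e /andP[lt_pe e_stop] min_e.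
have le_e : e <= size w by apply: min_e; rewrite eqxx orbT sz_w ltp.
have eq_e : J u e = J w e.
  case/orP: e_stop => [/eq_J//|/eqP->].
  by rewrite {1}sz_w -sz_u !take_size top_u.
have le_p : ~~ aprec ao (nth \bot u p)%O (nth \bot w p)%O.
  apply: (greedy_min gw le_e).
  - move=> j /andP[lt_pj lt_je]; apply: contraTN lt_je => jS.
    by rewrite -leqNgt min_e // lt_pj jS.
  - by rewrite nth_atom // sz_u.
  - by rewrite -eq_e nth_le_joinseq.
  - by rewrite -eq_tk basis_word_nle // sz_u.
apply/ltnW/(@code_lt _ _ p); rewrite ?sz_w //.
rewrite /aprec ltn_neqAle leqNgt le_p andbT.
by apply: contra neq_p => /eqP/index_ao_inj ->; rewrite ?nth_atom ?sz_u ?sz_w.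
Qed.

End Geometric.
End Words.

(** * Greedy words of chains *)

Section Chains.
Context (disp : Order.disp_t) (L : finTBLatticeType disp).
Implicit Types (t u w : seq L) (a b : L).
Local Notation J w j := (joinseq (take j w)).
Local Notation n := (rank (\top : L)%O).

Context (geoL : geometric L) (ao : seq L) (ao_atoms : atom_order ao).
Context (S : seq nat) (S_sorted : sorted ltn S).
Context (S_bounds : all (fun s => 0 < s < n) S).

Let S_gt0 : all (fun s => 0 < s) S.
Proof. by apply: sub_all S_bounds => s /andP[]. Qed.

Let S_nth i : i < size S -> 0 < nth 0 S i < n.
Proof. by move=> lti; apply: (allP S_bounds); apply: mem_nth. Qed.

Lemma simplex_ranks_sorted t : simplexS S t -> sorted ltn (map (@rank _ L) t).
Proof.
case/andP=> sort_t _.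
by apply: homo_sorted sort_t => x y; apply: rank_lt.
Qed.

Lemma simplex_ranks_sub t : simplexS S t -> {subset map (@rank _ L) t <= S}.
Proof. by case/andP=> _ /allP rkS _ /mapP[x /rkS ? ->]. Qed.

Lemma simplex_size t : simplexS S t -> size t <= size S.
Proof.
move=> simp_t; rewrite -(size_map (@rank _ L)); apply: uniq_leq_size.
  by apply: sorted_uniq (simplex_ranks_sorted simp_t); [apply: ltn_trans|apply: ltnn].
exact: simplex_ranks_sub.
Qed.

Lemma simplex_ranks t : simplexS S t -> size t = size S -> map (@rank _ L) t = S.
Proof.
move=> simp_t sz_t.
have sort_t := simplex_ranks_sorted simp_t.
apply: (irr_sorted_eq ltn_trans ltnn sort_t S_sorted).
have uniq_t : uniq (map (@rank _ L) t).
  by apply: sorted_uniq sort_t; [apply: ltn_trans | apply: ltnn].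
have [] // := uniq_min_size uniq_t (simplex_ranks_sub simp_t).
by rewrite size_map sz_t.
Qed.

Lemma simplex_fchain u : basis_word u -> simplexS S (fchain S u).
Proof.
move=> bas_u; have [/and3P[_ /eqP sz_u _]] := (bas_u).
have rk_i i : i < size S -> rank (J u (nth 0 S i)) = nth 0 S i.
  by move=> /S_nth/andP[_ ltn]; rewrite basis_word_rank // sz_u ltnW.
apply/andP; split.
  apply/(sortedP \bot%O) => i; rewrite size_tuple => lti.
  have ltS : nth 0 S i < nth 0 S i.+1 by apply: (sortedP 0 S_sorted).
  rewrite -(tnth_nth _ _ (Ordinal lti)) -(tnth_nth _ _ (Ordinal (ltnW lti))).
  rewrite !tnth_mktuple /= lt_neqAle joinseq_homo 1?ltnW // andbT.
  by apply/eqP => /(congr1 (@rank _ L)); rewrite !rk_i // 1?ltnW //; lia.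
by apply/all_tnthP => i; rewrite tnth_mktuple rk_i // mem_nth.
Qed.

(** Letter q is chosen as the least atom below [y q] outside the span of the earlier letters. One
    exists because q atoms span rank at most q, less than that of [y q]. *)
Lemma greedy_filling (y : nat -> L) (m : nat) :
  (forall p q, p <= q -> (y p <= y q)%O) -> (forall q, q < m -> q < rank (y q)) ->
  exists w, [/\ size w = m, all (@atom _ L) w &
    forall q, q < m -> [/\ (nth \bot w q <= y q)%O, ~~ (nth \bot w q <= J w q)%O &
      forall b, atom b -> (b <= y q)%O -> ~~ (b <= J w q)%O ->
        ~~ aprec ao b (nth \bot w q)%O]].
Proof.
move=> y_homo; elim: m => [|m IHm] rk_y; first by exists [::].
have [|w [sz_w at_w gw]] := IHm; first by move=> q ltq; apply/rk_y/ltnW.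
have lt_wy : (joinseq w < y m)%O.
  have le_wy : (joinseq w <= y m)%O.
    rewrite -(take_size w) sz_w; apply: joinseq_le => i lti.
    by have [le_i _ _] := gw i lti; apply: le_trans le_i (y_homo _ _ (ltnW lti)).
  rewrite lt_neqAle le_wy andbT; apply/eqP => eq_wy.
  have := rank_joinseq_le geoL at_w; rewrite eq_wy sz_w.
  by have := rk_y m (leqnn _); lia.
have [a0 [at0 le0 nle0]] := exists_atom geoL lt_wy.
have := @arg_minnP _ a0 (fun a => [&& atom a, (a <= y m)%O & ~~ (a <= joinseq w)%O])
  (fun a => index a ao).
rewrite at0 le0 nle0 => /(_ isT) [a /and3P[at_a le_a nle_a] min_a].
exists (rcons w a); rewrite size_rcons sz_w all_rcons at_a; split=> // q.
have tk_q p : p <= m -> take p (rcons w a) = take p w.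
  by move=> lep; rewrite -cats1 takel_cat // sz_w.
rewrite ltnS leq_eqVlt => /predU1P[->|ltq].
  rewrite tk_q // -sz_w take_size nth_rcons ltnn eqxx sz_w; split=> // b at_b le_b nle_b.
  by rewrite /aprec -leqNgt min_a // at_b le_b.
by rewrite tk_q 1?ltnW // nth_rcons sz_w ltq; apply: gw.
Qed.

Lemma exists_greedy t : simplexS S t -> size t = size S ->
  exists2 w, greedy ao S w &
    forall i, i < size S -> J w (nth 0 S i) = nth \bot%O t i.
Proof.
move=> simp_t sz_t; have rk_t := simplex_ranks simp_t sz_t.
have rk_nth i : i < size S -> rank (nth \bot%O t i) = nth 0 S i.
  by move=> lti; rewrite -[in RHS]rk_t (nth_map \bot%O) // sz_t.
(* [y q] is the flat of the chain at which the row of q ends; the default \top closes the last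
   row. *)
pose y q := nth \top%O t (rib_row S q).
have y_nth q : rib_row S q < size S -> y q = nth \bot%O t (rib_row S q).
  by move=> ltq; apply: set_nth_default; rewrite sz_t.
have y_top q : size S <= rib_row S q -> y q = \top%O.
  by move=> leq; rewrite /y nth_default // sz_t.
have t_homo i j : i <= j -> j < size S -> (nth \bot t i <= nth \bot t j)%O.
  move=> le_ij ltj; have [sort_t _] := andP simp_t.
  rewrite le_eqVlt; case: (ltngtP i j) le_ij => // [lt_ij|->]; rewrite ?eqxx // => _.
  by rewrite (sorted_ltn_nth lt_trans) ?orbT // inE sz_t // (ltn_trans lt_ij).
have y_homo p q : p <= q -> (y p <= y q)%O.
  move=> /(rib_row_homo S_sorted) le_row.
  have [ltq|leq] := ltnP (rib_row S q) (size S); last by rewrite (y_top _ leq) lex1.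
  by rewrite !y_nth ?t_homo // (leq_ltn_trans le_row).
have rk_y q : q < n -> q < rank (y q).
  move=> ltq; have [ltr|ler] := ltnP (rib_row S q) (size S); last by rewrite y_top.
  by rewrite y_nth // rk_nth // ltnNge leq_nth_rib_row // ltnn.
have [w [sz_w at_w gw]] := greedy_filling y_homo rk_y.
have bas_w : basis_word w.
  by apply: basis_wordI => // j; rewrite sz_w => /gw[].
have le_Jy j : j < n -> (J w j.+1 <= y j)%O.
  move=> ltj; apply: joinseq_le => i; rewrite ltnS => lei.
  by have [le_i _ _] := gw i (leq_ltn_trans lei ltj); apply: le_trans le_i (y_homo _ _ lei).
exists w.
  split=> // j; rewrite sz_w => ltj.
    have [_ _ min_j] := gw j ltj => b at_b le_b; apply: min_j => //.
    exact: le_trans le_b (le_Jy j ltj).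
  move=> nS; have ltj' := ltnW ltj.
  have eq_y : y j.+1 = y j by rewrite /y rib_rowS // (negbTE nS) addn0.
  have [_ _ min_j] := gw j ltj'; have [le_j1 nle_j1 _] := gw _ ltj.
  have at_j1 : atom (nth \bot%O w j.+1) by rewrite nth_atom ?sz_w.
  (* Letters of one row share the bound y, so letter j.+1 was already a candidate at step j. *)
  have : ~~ aprec ao (nth \bot%O w j.+1) (nth \bot%O w j).
    apply: min_j => //; first by rewrite -eq_y.
    by apply: contra nle_j1 => /le_trans; apply; apply: joinseq_homo.
  rewrite /aprec -leqNgt ltn_neqAle => ->; rewrite andbT.
  apply/eqP => /(index_ao_inj ao_atoms); rewrite !nth_atom ?sz_w // => /(_ isT isT) eq_j.
  by rewrite -eq_j nth_le_joinseq in nle_j1.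
(* The prefix of length s_i ends at position s_i - 1, in a row of index at most i, so its join lies
   below t_i; both have rank s_i. *)
move=> i lti; have /andP[gt0 ltn] := S_nth lti.
apply: rank_eq; last by rewrite rk_nth // basis_word_rank // sz_w ltnW.
rewrite -(prednK gt0) (le_trans (le_Jy _ (leq_ltn_trans (leq_pred _) ltn))) //.
have le_row : rib_row S (nth 0 S i).-1 <= i.
  by rewrite leqNgt -leq_nth_rib_row // -ltnNge prednK.
by rewrite y_nth ?t_homo // (leq_ltn_trans le_row).
Qed.

(** Column indices never decrease in reading order, so every position after q up to p lies in [S],
    and the descents there compose. *)
Lemma rib_col_descent w :
  (forall j, j.+1 < size w -> j.+1 \in S -> aprec ao (nth \bot w j.+1)%O (nth \bot w j)%O) ->
  forall p q, q < p -> p < size w -> rib_col S p = rib_col S q ->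
    aprec ao (nth \bot w p)%O (nth \bot w q)%O.
Proof.
move=> desc; elim=> // p IHp q; rewrite ltnS leq_eqVlt => /predU1P[->|lt_qp] ltp eq_col.
  apply: desc => //; apply: contraT => nS.
  by move: eq_col; rewrite rib_colS // nS; lia.
have le1 := rib_col_homo S_sorted S_gt0 (ltnW lt_qp).
have eqS := rib_colS S_sorted S_gt0 p.
have pS : p.+1 \in S by apply: contraT => nS; rewrite nS in eqS; lia.
rewrite pS in eqS.
by apply: ltn_trans (desc _ ltp pS) (IHp _ lt_qp (ltnW ltp) _); lia.
Qed.

(** Adjacent boxes of a row give the ascents and adjacent boxes of a column the descents; the
    minimum condition of [nbc_plus] is the greedy one. Conversely, these local conditions imply the
    global ones. *)
Lemma greedyP w : size w = n ->
  standard ao S w /\ nbc_plus ao w <->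
  greedy ao S w /\ (forall j, j.+1 < size w -> j.+1 \in S ->
                      aprec ao (nth \bot w j.+1)%O (nth \bot w j)%O).
Proof.
move=> sz_w; split.
  case=> [[at_w std_w] [[_ _ rk_w _] _ loc_w]]; split; first split.
  - by apply: basis_wordI => // j /loc_w[].
  - by move=> j /loc_w[].
  - move=> j ltj nS; apply: (proj1 (std_w j j.+1 (ltnW ltj) ltj)).
      by rewrite rib_rowS // (negbTE nS) addn0.
    by rewrite rib_colS // nS addn1.
  - move=> j ltj jS; apply: (proj2 (std_w j.+1 j ltj (ltnW ltj))).
      by rewrite rib_colS // jS addn0.
    by rewrite rib_rowS // jS addn1.
case=> gw desc; have [bas_w loc_w asc_w] := gw.
have [/and3P[at_w _ /eqP top_w]] := (bas_w).
split; split=> //.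
- move=> p q ltp ltq; split.
    move=> eq_row lt_col.
    have lt_pq : p < q by move: lt_col; rewrite /rib_col eq_row; lia.
    have offS j : p < j <= q -> j \notin S.
      case: j => // j /andP[lt_pj le_jq]; apply/negP => jS.
      have := rib_row_homo S_sorted lt_pj; have := rib_row_homo S_sorted le_jq.
      have := rib_rowS S_sorted j; have := rib_row_homo S_sorted (lt_pj : p <= j).
      by rewrite jS; lia.
    apply: (@leq_trans (index (nth \bot%O w p.+1) ao)).
      by apply: asc_w; [apply: leq_ltn_trans ltq | apply: offS; rewrite leqnn].
    apply: (greedy_ascent gw) => // j /andP[ltj lej]; apply: offS.
    by rewrite lej ltnW.
  move=> eq_col lt_row; apply: rib_col_descent => //.
  by rewrite ltnNge; apply: contraL lt_row => /(rib_row_homo S_sorted); rewrite leqNgt.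
- split=> //; first exact: (basis_word_uniq geoL).
    by rewrite top_w.
  move=> a at_a a_w le_a.
  (* Take the shortest prefix whose join lies above a: by greediness a does not precede its last
     letter, so that letter precedes a. *)
  have ex_q : exists q, (a <= J w q)%O by exists (size w); rewrite take_size.
  case: (ex_minnP ex_q) => -[|q] le_aq min_q.
    by case/coversP: at_a; rewrite take0 joinseq_nil lex0 in le_aq; rewrite (eqP le_aq) ltxx.
  have nle_aq : ~~ (a <= J w q)%O by apply/negP => /min_q; rewrite ltnn.
  have ltq : q < size w.
    rewrite ltnNge; apply: contra nle_aq => leq.
    by rewrite take_oversize.
  apply/hasP; exists (nth \bot%O w q); first exact: mem_nth.
  rewrite /aprec ltn_neqAle leqNgt [X in _ && X](loc_w q ltq a) // andbT.
  apply: contra a_w => /eqP/(index_ao_inj ao_atoms) <- //; first exact: mem_nth.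
  exact: nth_atom.
- move=> j ltj; split; first exact: nth_atom.
  + exact: nth_le_joinseq.
  + exact: (basis_word_nle geoL).
  + exact: loc_w.
Qed.

End Chains.

(** * Column permutations *)

(** If i and j differ, the entry at i survives the omission of j but not that of i. *)
Lemma omit_nth_inj (T : eqType) (x0 : T) (s : seq T) i j : uniq s -> i < size s -> j < size s ->
  take i s ++ drop i.+1 s = take j s ++ drop j.+1 s -> i = j.
Proof.
move=> uniq_s lti ltj eq_del; apply/eqP; apply: contraT => neq_ij.
have : nth x0 s i \in take j s ++ drop j.+1 s.
  rewrite mem_cat; apply/orP; move: neq_ij; rewrite neq_ltn => /orP[lt_ij|lt_ji].
    by left; rewrite -(nth_take x0 lt_ij) mem_nth // size_take ltj.
  right; rewrite -(subnKC lt_ji) -nth_drop mem_nth // size_drop; lia.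
rewrite -eq_del; move: uniq_s.
rewrite -{1}(cat_take_drop i s) (drop_nth x0) // cat_uniq /= mem_cat.
by case/and3P=> _ /norP[/negbTE-> _] /andP[/negbTE-> _].
Qed.

Section DeleteAt.
Context (disp : Order.disp_t) (L : finTBLatticeType disp).
Implicit Types s t : seq L.

Lemma delete_at_eq i s t : size s = size t ->
  (forall j, j != i -> nth \bot%O s j = nth \bot%O t j) -> delete_at i s = delete_at i t.
Proof.
move=> eq_sz eq_nth; congr (_ ++ _).
  apply: (@eq_from_nth _ \bot%O) => [|j]; rewrite !size_take eq_sz // => ltj.
  have ltji : j < i by case: ifP ltj => //; lia.
  by rewrite !nth_take // eq_nth // neq_ltn ltji.
apply: (@eq_from_nth _ \bot%O) => [|j ltj]; rewrite ?size_drop ?eq_sz // !nth_drop eq_nth //.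
by lia.
Qed.

Lemma delete_at_nth i s t j : size s = size t -> delete_at i s = delete_at i t ->
  j != i -> nth \bot%O s j = nth \bot%O t j.
Proof.
move=> eq_sz /eqP; rewrite /delete_at eqseq_cat ?size_take ?eq_sz //.
move=> /andP[/eqP eq_tk /eqP eq_dr].
rewrite neq_ltn => /orP[ltj|ltj].
  by rewrite -(nth_take \bot%O ltj) eq_tk nth_take.
by rewrite -(subnKC ltj) -!nth_drop eq_dr.
Qed.

End DeleteAt.

(** Right multiplication by tau swaps the even and odd members of G and preserves g, so the two
    halves cancel termwise. *)
Lemma signed_sum_eq0 (C : pzRingType) n (G : {set {perm 'I_n}}) (tau : {perm 'I_n})
    (g : {perm 'I_n} -> C) :
  odd_perm tau -> (forall s, (s * tau \in G)%g = (s \in G)) ->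
  (forall s, g (s * tau)%g = g s) ->
  (\sum_(s in G) (-1) ^+ odd_perm s * g s = 0)%R.
Proof.
move=> odd_tau G_tau g_tau; rewrite (bigID (@odd_perm _)) /=.
rewrite (reindex_inj (mulIg tau)) /=.
under eq_bigl do rewrite G_tau odd_permM odd_tau addbT.
rewrite -big_split /= big1 // => s /andP[_ /negbTE even_s].
by rewrite odd_permM odd_tau even_s g_tau /= expr0 expr1 mulN1r mul1r addNr.
Qed.

Section Polytabloids.
Context (disp : Order.disp_t) (L : finTBLatticeType disp).
Implicit Types (t u : seq L) (a b : L).
Local Notation J w j := (joinseq (take j w)).
Local Notation n := (rank (\top : L)%O).
Implicit Types (w : n.-tuple L) (s : {perm 'I_n}).

Context (geoL : geometric L) (ao : seq L) (ao_atoms : atom_order ao).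
Context (S : seq nat) (S_sorted : sorted ltn S).
Context (S_bounds : all (fun j => 0 < j < n) S).

Lemma size_act_filling s w : size (act_filling s w) = n.
Proof. by rewrite size_map size_enum_ord. Qed.

Lemma nth_act_filling s w (p : 'I_n) : nth \bot%O (act_filling s w) p = tnth w (s^-1%g p).
Proof. by rewrite (nth_map p) ?size_enum_ord // nth_ord_enum. Qed.

Lemma perm_act_filling s w : perm_eq (act_filling s w) w.
Proof. by apply/tuple_permP; exists (s^-1)%g. Qed.

Lemma act_filling1 w : act_filling 1 w = w :> seq L.
Proof.
apply: (@eq_from_nth _ \bot%O); rewrite ?size_act_filling ?size_tuple // => p ltp.
by rewrite (nth_act_filling _ _ (Ordinal ltp)) invg1 perm1 (tnth_nth \bot%O).
Qed.

Lemma basis_act_filling s w : basis_word (act_filling s w) = basis_word w.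
Proof. exact/basis_word_perm/perm_act_filling. Qed.

(** Box p receives the entry of box s^-1 p. At the first moved p this is a later box of the same
    column, whose entry is smaller, and all earlier boxes keep theirs. *)
Lemma code_act_filling s w : all (@atom _ L) w ->
  (forall j, j.+1 < size w -> j.+1 \in S ->
     aprec ao (nth \bot w j.+1)%O (nth \bot w j)%O) ->
  s \in col_group S n -> s != 1%g -> code ao (act_filling s w) < code ao w.
Proof.
move=> at_w desc col_s neq_s1.
have [p0 mov_p0] : exists p, (s^-1)%g p != p.
  apply/existsP; apply: contraR neq_s1 => /existsPn fix_s.
  rewrite -invg_eq1; apply/eqP/permP => p; rewrite perm1.
  by apply/eqP; rewrite -[_ == _]negbK fix_s.
have [p mov_p min_p] :=
  @arg_minnP _ p0 (fun p => (s^-1)%g p != p) (fun p : 'I_n => p : nat) mov_p0.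
have fix_q (q : 'I_n) : q < p -> (s^-1)%g q = q.
  by move=> ltq; apply/eqP; apply: contraTT ltq => /min_p; rewrite -leqNgt.
have lt_p : p < (s^-1)%g p.
  rewrite ltn_neqAle leqNgt; apply/andP; split.
    by apply: contra mov_p => /eqP/val_inj <-.
  apply/negP => /fix_q /perm_inj eq_p.
  by rewrite eq_p eqxx in mov_p.
have eq_sz : size (act_filling s w) = size w by rewrite size_act_filling size_tuple.
apply: (code_lt ao_atoms (p := nat_of_ord p)) => //.
- by rewrite (perm_all _ (perm_act_filling s w)).
- by rewrite size_act_filling.
- apply: (@eq_from_nth _ \bot%O); rewrite !size_take eq_sz // => q.
  rewrite size_tuple ltn_ord => ltq; have ltqn := ltn_trans ltq (ltn_ord p).
  rewrite !nth_take // (nth_act_filling _ _ (Ordinal ltqn)) fix_q //.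
  by rewrite (tnth_nth \bot%O).
rewrite nth_act_filling (tnth_nth \bot%O); apply: (rib_col_descent S_sorted) => //.
- by rewrite size_tuple.
by move: col_s; rewrite inE => /forallP/(_ (s^-1%g p)); rewrite permKV => /eqP.
Qed.

(** As an unordered join over boxes, a prefix join can be reindexed by a permutation. *)
Lemma joinseq_act_filling s w q :
  J (act_filling s w) q = (\join_(p < n | (p < q)%N) tnth w (s^-1%g p))%O.
Proof.
apply/eqP; rewrite eq_le; apply/andP; split.
  apply: joinseq_le => i ltiq; have [lti|lei] := ltnP i n.
    rewrite (nth_act_filling _ _ (Ordinal lti)).
    exact: (@joins_sup _ _ _ (Ordinal lti)).
  by rewrite nth_default ?le0x // size_act_filling.
by apply/joinsP => p ltp; rewrite -nth_act_filling nth_le_joinseq.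
Qed.

Section Adjacent.
Context (p q : 'I_n) (eq_pq : q = p.+1 :> nat) (q_S : nat_of_ord q \in S).

Lemma col_group_tperm s : ((s * tperm p q)%g \in col_group S n) = (s \in col_group S n).
Proof.
have S_gt0 : all (fun j => 0 < j) S by apply: sub_all S_bounds => j /andP[].
have eq_col r : rib_col S (tperm p q r) = rib_col S r.
  have := rib_colS S_sorted S_gt0 p; rewrite -eq_pq q_S addn0 => eq_col.
  by case: tpermP => [->|->|//].
by rewrite !inE; apply: eq_forallb => r; rewrite permM eq_col.
Qed.

(** A prefix whose length is not q contains both of the boxes p and q or neither. *)
Lemma joinseq_act_tperm s w (j : nat) : j != nat_of_ord q ->
  J (act_filling (s * tperm p q) w) j = J (act_filling s w) j.
Proof.
move=> neq_jq; rewrite !joinseq_act_filling [RHS](reindex_inj (@perm_inj _ (tperm p q))).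
apply: eq_big => [r|r _]; last by rewrite invMg permM tpermV.
by case: tpermP => [->|->|//]; move: neq_jq; rewrite eq_pq; lia.
Qed.

End Adjacent.

Lemma tnth_fchain u (i : 'I_(size S)) : tnth (fchain S u) i = J u (nth 0 S i).
Proof. by rewrite tnth_mktuple. Qed.

Lemma fchain_eqP u v :
  fchain S u = fchain S v <-> (forall j, j \in S -> J u j = J v j).
Proof.
split=> [eq_ch j jS|eq_J].
  have lti : index j S < size S by rewrite index_mem.
  have := congr1 (@tnth _ _ ^~ (Ordinal lti)) eq_ch.
  by rewrite !tnth_fchain /= nth_index.
by apply: eq_from_tnth => i; rewrite !tnth_fchain eq_J // mem_nth.
Qed.

Context (C : fieldType).

Lemma fchain_vF_support w (t : (size S).-tuple L) :
  fchain_vF C S w t != 0%R ->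
  exists2 s, s \in col_group S n & t = fchain S (act_filling s w).
Proof.
rewrite ffunE => neq0.
have [/existsP[s /andP[col_s /eqP eq_t]]|/existsPn all_s] :=
  boolP [exists s, (s \in col_group S n) && (t == fchain S (act_filling s w))].
  by exists s.
case/eqP: neq0; apply: big1 => s col_s.
by have := all_s s; rewrite col_s /= => /negbTE->; rewrite mulr0.
Qed.

(* The transposition of the two boxes s_i - 1 and s_i of a common column only
   changes the flat of rank s_i and reverses the sign, so the faces omitting
   that flat cancel in pairs. *)
Lemma fchain_vF_cycle w : basis_word w -> is_cycle S (fchain_vF C S w).
Proof.
move=> bas_w; split=> [t|u].
  apply: contraNeq => /fchain_vF_support[s _ ->].
  by apply: simplex_fchain; rewrite ?basis_act_filling.
rewrite /bdry.
transitivity (\sum_(i < size S) (-1) ^+ i * \sum_(s in col_group S n) (-1) ^+ odd_perm s *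
    (u == delete_at i (fchain S (act_filling s w)))%:R : C)%R.
  rewrite exchange_big /=; apply: eq_bigr => i _.
  under eq_bigr do rewrite ffunE mulr_sumr.
  rewrite exchange_big mulr_sumr /=; apply: eq_bigr => s _.
  have simp_s : simplexS S (fchain S (act_filling s w)).
    by apply: simplex_fchain; rewrite ?basis_act_filling.
  rewrite (bigD1 (fchain S (act_filling s w))) //= eqxx mulr1.
  rewrite big1 ?addr0 => [|t /andP[_ /negbTE->]].
    by rewrite -mulrA; congr (_ * _)%R; rewrite mulrC.
  by rewrite !mulr0.
apply: big1 => i _; rewrite (_ : \sum_(s in _) _ = 0)%R ?mulr0 //.
have /andP[gt0 ltn] := allP S_bounds _ (mem_nth 0 (ltn_ord i)).
have ltn' : (nth 0 S i).-1 < n by rewrite (leq_ltn_trans (leq_pred _)).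
pose p := Ordinal ltn'; pose q := Ordinal ltn.
have eq_pq : q = p.+1 :> nat by rewrite /= prednK.
have q_S : nat_of_ord q \in S by apply: mem_nth.
apply: (signed_sum_eq0 (tau := tperm p q)).
- by rewrite odd_tperm -val_eqE neq_ltn /= ltn_predL gt0.
- exact: (col_group_tperm eq_pq q_S).
move=> s; congr ((u == _)%:R)%R; apply: delete_at_eq.
  by rewrite !size_tuple.
move=> j neq_ji; have [ltj|lej] := ltnP j (size S); last by rewrite !nth_default ?size_tuple.
rewrite -!(tnth_nth _ _ (Ordinal ltj)) !tnth_fchain (joinseq_act_tperm eq_pq) //=.
have S_uniq : uniq S by apply: sorted_uniq S_sorted; [apply: ltn_trans|apply: ltnn].
by rewrite nth_uniq.
Qed.

End Polytabloids.

(** * Top homology *)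

Section TopHomology.
Context (disp : Order.disp_t) (L : finTBLatticeType disp).
Local Notation J w j := (joinseq (take j w)).
Local Notation n := (rank (\top : L)%O).
Implicit Types (w : n.-tuple L).

Context (geoL : geometric L) (ao : seq L) (ao_atoms : atom_order ao).
Context (S : seq nat) (S_sorted : sorted ltn S).
Context (S_bounds : all (fun j => 0 < j < n) S).
Context (C : fieldType).
Local Notation x := (fchain_vF C S).
Implicit Types z : {ffun (size S).-tuple L -> C}.

Let S_uniq : uniq S.
Proof. by apply: sorted_uniq S_sorted; [apply: ltn_trans | apply: ltnn]. Qed.

(** Chains of P^S have at most [size S] elements, so the sum defining a boundary from the next
    degree is empty. *)
Lemma top_boundaryP z : is_boundary S z <-> forall t, z t = 0%R.
Proof.
split=> [[y [_ bdry_y]] t|z0].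
  rewrite bdry_y /bdry big_pred0 // => t'; apply/negP => /simplex_size.
  by rewrite size_tuple ltnn.
exists [ffun=> 0%R]; split=> [t _|t]; first by rewrite ffunE.
by rewrite z0 /bdry big1 // => t' _; rewrite big1 // => i _; rewrite ffunE mulr0.
Qed.

Lemma is_cycleB z z' (a : C) : is_cycle S z -> is_cycle S z' ->
  is_cycle S [ffun t => z t - a * z' t]%R.
Proof.
case=> supp_z cyc_z [supp_z' cyc_z']; split=> [t nsimp_t|u].
  by rewrite ffunE supp_z // supp_z' // mulr0 subr0.
transitivity (bdry S z u - a * bdry S z' u)%R; last by rewrite cyc_z cyc_z' mulr0 subr0.
rewrite /bdry mulr_sumr -sumrB; apply: eq_bigr => t _.
rewrite mulr_sumr -sumrB; apply: eq_bigr => i _.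
by rewrite ffunE mulrBr [in RHS]mulrCA.
Qed.

Let fam w := standard ao S w /\ nbc_plus ao w.

Lemma family_greedyP w : fam w <-> greedy ao S w /\
  (forall j, j.+1 < size w -> j.+1 \in S ->
     aprec ao (nth \bot w j.+1)%O (nth \bot w j)%O).
Proof. by apply: greedyP => //; rewrite size_tuple. Qed.

Lemma fchain_code_le (u v : seq L) : greedy ao S u -> basis_word v ->
  fchain S u = fchain S v -> code ao u <= code ao v.
Proof.
move=> gu bas_v /fchain_eqP eq_J.
by apply: (greedy_code_le geoL ao_atoms gu bas_v) => j /eq_J.
Qed.

(** The chain of w is that of a column permutation of w'. The greedy w is at most this permuted
    word, which is at most w'. *)
Lemma fchain_vF_unitriangular w w' : greedy ao S w -> fam w' ->
  x w' (fchain S w) != 0%R -> code ao w <= code ao w'.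
Proof.
move=> gw /family_greedyP[[bas_w' _ _] desc] /fchain_vF_support[s col_s eq_ch].
have [/and3P[at_w' _ _]] := (bas_w').
have le_code : code ao w <= code ao (act_filling s w').
  by apply: fchain_code_le eq_ch; rewrite ?basis_act_filling.
have [eq_s|neq_s] := eqVneq s 1%g; first by rewrite eq_s act_filling1 in le_code.
apply: leq_trans le_code (ltnW _).
exact: (code_act_filling ao_atoms S_sorted S_bounds at_w' desc col_s neq_s).
Qed.

(** Nontrivial column permutations lower the word, but w is the least word of its chain, so only the
    identity contributes. *)
Lemma fchain_vF_diag w : fam w -> x w (fchain S w) = 1%R.
Proof.
move=> /family_greedyP[gw desc]; have [bas_w _ _] := gw; have [/and3P[at_w _ _]] := (bas_w).
rewrite ffunE (bigD1 1%g) /=; last first.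
  by rewrite inE; apply/forallP => p; rewrite perm1.
rewrite odd_perm1 expr0 act_filling1 eqxx mulr1 big1 ?addr0 // => s /andP[col_s neq_s].
case: eqP => [eq_ch|_]; last by rewrite mulr0.
have lt_code := code_act_filling ao_atoms S_sorted S_bounds at_w desc col_s neq_s.
suff : code ao w <= code ao (act_filling s w) by rewrite leqNgt lt_code.
by apply: fchain_code_le eq_ch; rewrite ?basis_act_filling.
Qed.

Lemma code_tuple_inj w w' : basis_word w -> basis_word w' ->
  code ao w = code ao w' -> w = w'.
Proof.
move=> /and3P[at_w _ _] /and3P[at_w' _ _] eq_code; apply: val_inj.
by apply: (code_inj ao_atoms) eq_code; rewrite ?size_tuple.
Qed.

Lemma simplex_greedy (t : (size S).-tuple L) : simplexS S t ->
  exists2 w : n.-tuple L, greedy ao S w & fchain S w = t.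
Proof.
move=> simp_t.
have [w gw eq_w] := exists_greedy geoL ao_atoms S_sorted S_bounds simp_t (size_tuple t).
have [/and3P[_ sz_w _] _ _] := gw.
exists (Tuple sz_w) => //; apply: eq_from_tnth => i.
by rewrite tnth_fchain eq_w // (tnth_nth \bot%O).
Qed.

(** The boundary of z vanishes at the face of t omitting vertex i, so the term of t must be
    cancelled by another simplex. *)
Lemma cycle_partner z (t : (size S).-tuple L) (i : 'I_(size S)) :
  is_cycle S z -> z t != 0%R ->
  exists t' : (size S).-tuple L,
    [/\ t' != t, simplexS S t', z t' != 0%R & delete_at i t' = delete_at i t].
Proof.
case=> supp_z cyc_z z_t.
have simp_t : simplexS S t by apply: contraNT z_t => /supp_z->.
(* All maximal simplices have rank set [S], so the ranks of a face reveal which index was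
   omitted. *)
have del_inj (t' : (size S).-tuple L) (j : 'I_(size S)) :
    simplexS S t' -> delete_at i t = delete_at j t' -> i = j.
  move=> simp_t' /(congr1 (map (@rank _ L))).
  rewrite !map_cat !map_take !map_drop.
  rewrite (simplex_ranks S_sorted simp_t (size_tuple t)).
  rewrite (simplex_ranks S_sorted simp_t' (size_tuple t')).
  by move=> eq_del; apply: val_inj; apply: (omit_nth_inj 0 S_uniq) eq_del; apply: ltn_ord.
pose Q (t' : (size S).-tuple L) :=
  [&& t' != t, simplexS S t', z t' != 0%R & delete_at i t' == delete_at i t].
have [/existsP[t' /and4P[? ? ? /eqP ?]]|/existsPn no_t'] := boolP [exists t', Q t'].
  by exists t'.
(* Without a partner, the boundary at this face is [z t] up to sign. *)
case/eqP: z_t; have := cyc_z (delete_at i t); rewrite /bdry (bigD1 t) //=.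
rewrite [X in (_ + X)%R]big1 => [|t' /andP[simp_t' neq_t]]; last first.
  apply: big1 => j _; case: eqP => [eq_del|_]; last by rewrite mulr0 mul0r.
  have eq_ij := del_inj _ _ simp_t' eq_del; rewrite -eq_ij in eq_del *.
  have := no_t' t'; rewrite /Q neq_t simp_t' eq_del eqxx andbT /= negbK => /eqP->.
  by rewrite mulr0.
rewrite (bigD1 i) //= eqxx mulr1 big1 => [|j /negbTE neq_ji].
  by rewrite !addr0 => /eqP; rewrite mulf_eq0 signr_eq0 /= => /eqP.
case: eqP => [/(del_inj _ _ simp_t)/eqP|_]; first by rewrite eq_sym neq_ji.
by rewrite mulr0 mul0r.
Qed.

(* An ascent of w at some s in S would make w lexicographically least among
   all words agreeing with it off s, hence smaller than that of the second
   chain of the support of z through the face of fchain S w omitting rank s. *)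
Lemma maximal_support z w : is_cycle S z -> greedy ao S w ->
  z (fchain S w) != 0%R ->
  (forall w', greedy ao S w' -> z (fchain S w') != 0%R -> code ao w' <= code ao w) ->
  fam w.
Proof.
move=> cyc_z gw z_w max_w; apply/family_greedyP; split=> // j ltj jS.
have [bas_w loc_w asc_w] := gw; have [/and3P[at_w _ _]] := (bas_w).
have ltj' := ltnW ltj.
case: (ltngtP (index (nth \bot%O w j.+1) ao) (index (nth \bot%O w j) ao)) => [//|asc_j|].
  have ltk : index j.+1 S < size S by rewrite index_mem.
  have [t' [neq_t simp_t' z_t' eq_del]] := cycle_partner (Ordinal ltk) cyc_z z_w.
  have [w' gw' eq_t'] := simplex_greedy simp_t'; have [bas_w' _ _] := gw'.
  have gw_j : greedy ao [seq q <- S | q != j.+1] w.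
    split=> // q ltq; rewrite mem_filter negb_and negbK => /orP[/eqP[->]//|].
    exact: asc_w.
  have le_code : code ao w <= code ao w'.
    apply: (greedy_code_le geoL ao_atoms gw_j bas_w') => q.
    rewrite mem_filter => /andP[neq_q qS].
    have ltq : index q S < size S by rewrite index_mem.
    have := @delete_at_nth _ _ _ t' (fchain S w) (index q S) _ eq_del.
    rewrite -eq_t' !size_tuple => /(_ erefl).
    rewrite -!(tnth_nth _ _ (Ordinal ltq)) !tnth_fchain /= nth_index //; apply.
    apply: contra neq_q => /eqP eq_idx.
    by rewrite -(nth_index 0 qS) eq_idx nth_index.
  have eq_w : w = w'.
    apply: code_tuple_inj => //; apply/eqP; rewrite eqn_leq le_code max_w //.
    by rewrite eq_t'.
  by rewrite -eq_t' -eq_w eqxx in neq_t.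
move/(index_ao_inj ao_atoms); rewrite !nth_atom // => /(_ isT isT)/eqP.
by rewrite nth_uniq ?(basis_word_uniq geoL) //; lia.
Qed.

(** Evaluate at the chain of the word of largest code with nonzero coefficient: by unitriangularity
    all other terms vanish there. *)
Lemma family_free (c : n.-tuple L -> C) : (forall w, ~ fam w -> c w = 0%R) ->
  (forall t, \sum_w c w * x w t = 0)%R -> forall w, c w = 0%R.
Proof.
move=> c0 sum0 w1; apply/eqP; apply: contraT => c_w1.
case: (@arg_maxnP _ w1 (fun w => c w != 0%R) (fun w => code ao w) c_w1) => w c_w max_w.
have famP w' : c w' != 0%R -> fam w'.
  by move=> c_w'; apply: contrapT => /c0 eq0; rewrite eq0 eqxx in c_w'.
have fam_w := famP w c_w; have /family_greedyP[gw _] := fam_w.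
case/eqP: c_w; have := sum0 (fchain S w).
rewrite (bigD1 w) //= fchain_vF_diag // mulr1 big1 ?addr0 // => w' neq_w'.
apply/eqP; rewrite mulf_eq0; have [//|c_w'] := eqVneq (c w') 0%R.
have fam_w' := famP w' c_w'; have /family_greedyP[[bas_w' _ _] _] := fam_w'.
apply: contraNT neq_w' => /(fchain_vF_unitriangular gw fam_w') le_code.
apply/eqP/code_tuple_inj => //; first by have [] := gw.
by apply/eqP; rewrite eqn_leq le_code andbT; apply: max_w.
Qed.

(** Induction on a strict bound m for the codes of the greedy words of the support; at m = 0 the
    support is empty, since every maximal simplex has a greedy word. *)
Lemma family_generates z : is_cycle S z ->
  exists c : n.-tuple L -> C, (forall w, ~ fam w -> c w = 0%R) /\
    forall t, z t = (\sum_w c w * x w t)%R.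
Proof.
suff gen m z' : is_cycle S z' ->
    (forall w, greedy ao S w -> z' (fchain S w) != 0%R -> code ao w < m) ->
    exists c : n.-tuple L -> C, (forall w, ~ fam w -> c w = 0%R) /\
      forall t, z' t = (\sum_w c w * x w t)%R.
  move=> cyc_z; apply: (gen (\max_(w : n.-tuple L) code ao w).+1) => // w _ _.
  by rewrite ltnS (leq_bigmax (F := fun w : n.-tuple L => code ao w)).
elim: m z' => [|m IHm] {}z cyc_z lt_m.
  exists (fun=> 0%R); split=> // t.
  rewrite big1 => [|w _]; last by rewrite mul0r.
  apply/eqP; apply: contraT => z_t.
  have simp_t : simplexS S t.
    by apply: contraNT z_t; case: cyc_z => supp_z _ /supp_z->.
  have [w gw eq_t] := simplex_greedy simp_t.
  by have := lt_m w gw; rewrite eq_t => /(_ z_t).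
(* If the largest allowed code m is attained, by w0, then w0 is maximal in the support and so
   belongs to the family. *)
have [[w0 [gw0 z_w0 code_w0]]|no_w0] :=
  pselect (exists w, [/\ greedy ao S w, z (fchain S w) != 0%R & code ao w = m]); last first.
  apply: IHm => // w gw z_w; have := lt_m w gw z_w.
  rewrite ltnS leq_eqVlt => /predU1P[code_w|//].
  by case: no_w0; exists w.
have fam_w0 : fam w0.
  by apply: (maximal_support cyc_z) => // w gw z_w; rewrite code_w0 -ltnS lt_m.
have [bas_w0 _ _] := gw0.
have [|w gw|c [c0 eq_c]] := IHm [ffun t => z t - z (fchain S w0) * x w0 t]%R.
- apply: is_cycleB cyc_z _; exact: (fchain_vF_cycle geoL S_sorted S_bounds C bas_w0).
- rewrite ffunE => neq0.
  (* The subtraction brings in only chains whose greedy words have code at most that of w0, and it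
     cancels the chain of w0 because the diagonal coefficient is 1. *)
  have : code ao w <= m.
    have [z_w|z_w] := eqVneq (z (fchain S w)) 0%R; last by rewrite -ltnS lt_m.
    rewrite -code_w0; apply: (fchain_vF_unitriangular gw fam_w0).
    by apply: contraNneq neq0 => ->; rewrite z_w mulr0 subr0.
  rewrite leq_eqVlt => /predU1P[code_w|//].
  have eq_w : w = w0 by apply: code_tuple_inj; rewrite ?code_w //; case: gw.
  by rewrite eq_w fchain_vF_diag // mulr1 subrr eqxx in neq0.
exists (fun w => c w + (w == w0)%:R * z (fchain S w0))%R; split=> [w nfam_w|t].
  by rewrite c0 //; case: eqP => [eq_w|_]; rewrite ?mul0r ?addr0 //; case: nfam_w; rewrite eq_w.
under eq_bigr do rewrite mulrDl.
rewrite big_split /= -eq_c ffunE (bigD1 w0) //= eqxx mul1r big1 => [|w /negbTE->].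
  by rewrite addr0 subrK.
by rewrite !mul0r.
Qed.
End TopHomology.

Theorem theorem5p29 (R : realType) (disp : Order.disp_t)
    (L : finTBLatticeType disp) (ao : seq L) (S : seq nat) :
  geometric L -> atom_order ao ->
  sorted ltn S -> all (fun s => 0 < s < rank (\top : L)%O) S ->
  let n := rank (\top : L)%O in
  let k := size S in
  let fam := fun w : n.-tuple L => standard ao S w /\ nbc_plus ao w in
  let x := fun w : n.-tuple L => fchain_vF (R[i]) S w in
  (* each f_chain(v_F) is a top-dimensional cycle, hence a homology class *)
  (forall w, fam w -> is_cycle S (x w)) /\
  (* the classes are linearly independent in H~_{k-1} = Z_{k-1} / B_{k-1} *)
  (forall c : n.-tuple L -> R[i], (forall w, ~ fam w -> c w = 0%R) ->
     is_boundary S [ffun t : k.-tuple L =>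
                      (\sum_(w : n.-tuple L) c w * x w t)%R] ->
     forall w, c w = 0%R) /\
  (* and they span H~_{k-1} *)
  (forall z : {ffun k.-tuple L -> R[i]}, is_cycle S z ->
     exists c : n.-tuple L -> R[i], (forall w, ~ fam w -> c w = 0%R) /\
       is_boundary S [ffun t : k.-tuple L =>
                        (z t - \sum_(w : n.-tuple L) c w * x w t)%R]).
Proof.
move=> geoL ao_atoms S_sorted S_bounds n k fam x.
have cyc w : fam w -> is_cycle S (x w).
  case/(family_greedyP geoL ao_atoms S_sorted S_bounds) => -[bas_w _ _] _.
  exact: fchain_vF_cycle.
split=> //; split=> [c c0 /top_boundaryP sum0|z cyc_z].
  apply: (family_free geoL ao_atoms S_sorted S_bounds c0) => t.
  by have := sum0 t; rewrite ffunE.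
have [c [c0 eq_c]] := family_generates geoL ao_atoms S_sorted S_bounds cyc_z.
exists c; split=> //; apply/top_boundaryP => t.
by rewrite ffunE eq_c subrr.
Qed.
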